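(* For each of the following $38$ sets $P$ of generalized patterns, $|S_n(P)|=n$ for every $n\ge 1$: $\{1\text{-}23,2\text{-}13,3\text{-}12,21\text{-}3\}$, $\{1\text{-}23,2\text{-}13,31\text{-}2,21\text{-}3\}$, $\{1\text{-}23,2\text{-}13,31\text{-}2,3\text{-}12\}$, $\{1\text{-}23,21\text{-}3,31\text{-}2,3\text{-}12\}$, $\{12\text{-}3,3\text{-}12,2\text{-}13,21\text{-}3\}$, $\{12\text{-}3,31\text{-}2,2\text{-}13,21\text{-}3\}$, $\{12\text{-}3,31\text{-}2,2\text{-}13,3\text{-}12\}$, $\{12\text{-}3,31\text{-}2,21\text{-}3,3\text{-}12\}$, $\{1\text{-}23,2\text{-}13,2\text{-}31,21\text{-}3\}$, $\{1\text{-}23,2\text{-}13,2\text{-}31,23\text{-}1\}$, $\{1\text{-}23,2\text{-}13,23\text{-}1,21\text{-}3\}$, $\{1\text{-}23,21\text{-}3,2\text{-}31,23\text{-}1\}$, $\{2\text{-}13,2\text{-}31,1\text{-}32,21\text{-}3\}$, $\{2\text{-}13,2\text{-}31,1\text{-}32,23\text{-}1\}$, $\{2\text{-}13,23\text{-}1,1\text{-}32,21\text{-}3\}$, $\{2\text{-}13,2\text{-}31,13\text{-}2,21\text{-}3\}$, $\{2\text{-}13,2\text{-}31,13\text{-}2,23\text{-}1\}$, $\{2\text{-}13,2\text{-}31,13\text{-}2,1\text{-}32\}$, $\{2\text{-}13,23\text{-}1,13\text{-}2,21\text{-}3\}$, $\{2\text{-}13,23\text{-}1,13\text{-}2,1\text{-}32\}$,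 $\{2\text{-}31,21\text{-}3,13\text{-}2,23\text{-}1\}$, $\{2\text{-}31,21\text{-}3,13\text{-}2,1\text{-}32\}$, $\{2\text{-}31,21\text{-}3,1\text{-}32,23\text{-}1\}$, $\{13\text{-}2,21\text{-}3,23\text{-}1,1\text{-}32\}$, $\{1\text{-}23,2\text{-}31,31\text{-}2,23\text{-}1\}$, $\{1\text{-}23,2\text{-}31,31\text{-}2,3\text{-}12\}$, $\{1\text{-}23,23\text{-}1,31\text{-}2,3\text{-}12\}$, $\{1\text{-}23,2\text{-}31,3\text{-}12,23\text{-}1\}$, $\{1\text{-}23,2\text{-}13,31\text{-}2,12\text{-}3\}$, $\{1\text{-}23,2\text{-}13,3\text{-}12,12\text{-}3\}$, $\{1\text{-}23,2\text{-}13,2\text{-}31,12\text{-}3\}$, $\{1\text{-}23,2\text{-}13,23\text{-}1,12\text{-}3\}$, $\{1\text{-}23,21\text{-}3,2\text{-}31,12\text{-}3\}$, $\{1\text{-}23,21\text{-}3,23\text{-}1,12\text{-}3\}$, $\{1\text{-}23,21\text{-}3,31\text{-}2,12\text{-}3\}$, $\{1\text{-}23,21\text{-}3,3\text{-}12,12\text{-}3\}$, $\{1\text{-}23,2\text{-}31,3\text{-}12,12\text{-}3\}$, $\{1\text{-}23,2\text{-}31,31\text{-}2,12\text{-}3\}$.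
   Context: $S_n$ is the set of permutations $\pi=\pi_1\pi_2\cdots\pi_n$ of $\{1,\dots,n\}$. For $abc$ a permutation of $123$, the generalized pattern $a\text{-}bc$ is contained in $\pi$ if there are indices $i<j$ with $j+1\le n$ such that $\pi_i\pi_j\pi_{j+1}$ is order-isomorphic to $abc$; the generalized pattern $ab\text{-}c$ is contained in $\pi$ if there are indices $i,k$ with $i+1<k\le n$ such that $\pi_i\pi_{i+1}\pi_k$ is order-isomorphic to $abc$. (Letters not separated by a dash must occur in adjacent positions; letters separated by a dash need not be adjacent.) $\pi$ avoids a pattern if it does not contain it. For a set $P$ of generalized patterns, $S_n(P)$ is the set of $\pi\in S_n$ avoiding every pattern in $P$. *)

(* Defs.v *)
From HB Require Import structures.
From mathcomp Require Import all_boot all_fingroup.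

Set Implicit Arguments.
Unset Strict Implicit.
Unset Printing Implicit Defensive.

(* A generalized pattern of length 3 with one dash: [A_BC a b c] is a-bc and
   [AB_C a b c] is ab-c, where abc is a permutation of 123. *)
Inductive gpattern := A_BC of nat & nat & nat | AB_C of nat & nat & nat.

Definition gpattern_code (p : gpattern) : bool * (nat * nat * nat) :=
  match p with
  | A_BC a b c => (true, (a, b, c))
  | AB_C a b c => (false, (a, b, c))
  end.

Definition gpattern_decode (x : bool * (nat * nat * nat)) : gpattern :=
  let: (d, (a, b, c)) := x in if d then A_BC a b c else AB_C a b c.

Lemma gpattern_codeK : cancel gpattern_code gpattern_decode.
Proof. by case. Qed.

HB.instance Definition _ := Equality.copy gpattern (can_type gpattern_codeK).

Notation "[gp a - b c ]" := (A_BC a b c)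
  (at level 0, a at level 0, b at level 0, c at level 0,
   format "[gp  a - b  c ]").
Notation "[gp a b - c ]" := (AB_C a b c)
  (at level 0, a at level 0, b at level 0, c at level 0,
   format "[gp  a  b - c ]").

Definition order_iso (s t : seq nat) : bool :=
  (size s == size t) &&
  [forall i : 'I_(size s), forall j : 'I_(size s),
     (nth 0 s i < nth 0 s j) == (nth 0 t i < nth 0 t j)].

(* A permutation of {1, ..., n} is an element of 'S_n, with positions and values
   both shifted down by 1; order-isomorphism is insensitive to the shift. *)
Definition contains n (pi : 'S_n) (p : gpattern) : bool :=
  match p with
  | A_BC a b c =>
      [exists i : 'I_n, exists j : 'I_n, exists k : 'I_n,
        [&& i < j, k == j.+1 :> nat &
            order_iso [:: val (pi i); val (pi j); val (pi k)] [:: a; b; c]]]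
  | AB_C a b c =>
      [exists i : 'I_n, exists j : 'I_n, exists k : 'I_n,
        [&& j == i.+1 :> nat, j < k &
            order_iso [:: val (pi i); val (pi j); val (pi k)] [:: a; b; c]]]
  end.

Definition avoids n (pi : 'S_n) (p : gpattern) : bool := ~~ contains pi p.

Definition avoiders n (P : seq gpattern) : {set 'S_n} :=
  [set pi : 'S_n | all (avoids pi) P].

(* Main.v *)
Require Import Defs.
From mathcomp Require Import all_boot all_fingroup.
From mathcomp Require Import zify.

Set Implicit Arguments.
Unset Strict Implicit.
Unset Printing Implicit Defensive.

(** Let T be the set of underlying classical patterns of P.  For the 38 sets, T
    is one of four triples, and for each triple the avoiders are the n + 1
    permutations of {0, ..., n} whose relative order at positions i < j is
    pi i < pi j <-> r m i j, for some m <= n, where r m i j is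
    - (i == 0) && (j <= m)   for T = {123, 213, 312},
    - i == m                 for T = {123, 213, 231},
    - m <= i                 for T = {213, 231, 132},
    - i <= m < j             for T = {123, 231, 312}.
    Such permutations avoid even the classical patterns of T.  Conversely, as
    each pattern of T occurs in P with some dash, no three consecutive letters
    form a pattern of T; in the last three cases m is the position of the first
    ascent (n if there is none), and the order is forced by a few noncontiguous
    patterns.  These are available because avoiding 2-13, 2-31 or 31-2 amounts
    to avoiding the classical pattern: in an occurrence of the latter, the
    sequence has to cross the middle value between two adjacent positions. *)

(** * Permutations determined by their relative order *)

Definition has_order n (r : rel nat) (pi : 'S_n.+1) : bool :=
  [forall i : 'I_n.+1, forall j : 'I_n.+1, (i < j) ==> ((pi i < pi j) == r i j)].

Lemma has_orderP n (r : rel nat) (pi : 'S_n.+1) :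
  reflect (forall i j : 'I_n.+1, i < j -> (pi i < pi j) = r i j)
          (has_order r pi).
Proof.
apply: (iffP forallP) => [H i j lt_ij|H i].
  by have /forallP/(_ j)/implyP/(_ lt_ij)/eqP := H i.
by apply/forallP=> j; apply/implyP=> lt_ij; rewrite H.
Qed.

(** [pi] maps this set bijectively onto the values below [pi i]. A value is thus a rank, recoverable
    from comparisons alone. *)
Lemma card_ltn_perm n (pi : 'S_n) (i : 'I_n) :
  #|[set j | pi j < pi i]| = pi i.
Proof.
rewrite -(card_imset _ (@perm_inj _ pi)).
rewrite (_ : imset _ _ = [set k : 'I_n | k < pi i]).
  rewrite cardsE -sum1_card (big_ord_narrow (ltnW (ltn_ord (pi i)))).
  by rewrite sum1_card card_ord.
apply/setP=> k; rewrite inE; apply/imsetP/idP => [[j]|lt_k].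
  by rewrite inE => lt_j ->.
by exists ((pi^-1)%g k); rewrite ?inE permKV.
Qed.

Lemma has_order_inj n (r : rel nat) (pi sigma : 'S_n.+1) :
  has_order r pi -> has_order r sigma -> pi = sigma.
Proof.
move=> /has_orderP Hp /has_orderP Hs; apply/permP=> i; apply: val_inj => /=.
rewrite -[LHS]card_ltn_perm -[RHS]card_ltn_perm.
apply: eq_card => j; rewrite !inE.
case: (ltngtP i j) => [lt_ij|lt_ji|/val_inj->]; last by rewrite !ltnn.
- have nij (t : 'S_n.+1) : (t j < t i) = ~~ (t i < t j).
    rewrite -leqNgt [RHS]leq_eqVlt (inj_eq val_inj) (inj_eq perm_inj).
    by case: eqP lt_ij => // ->; rewrite ltnn.
  by rewrite !nij Hp // Hs.
- by rewrite Hp // Hs.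
Qed.

(** Standardisation: each [f i] is replaced by its rank among [f 0], ..., [f n]; distinct values
    have distinct ranks. *)
Lemma has_order_exists n (f : nat -> nat) (r : rel nat) :
    (forall i j, i < j <= n -> f i != f j /\ (f i < f j) = r i j) ->
  exists pi : 'S_n.+1, has_order r pi.
Proof.
move=> Hf.
have lt_g (i : 'I_n.+1) : #|[set j : 'I_n.+1 | f j < f i]| < n.+1.
  rewrite -[X in _ < X]card_ord -cardsT; apply: proper_card.
  rewrite properE subsetT; apply/subsetPn; exists i => //.
  by rewrite inE ltnn.
pose g i := Ordinal (lt_g i).
have mono_g (i j : 'I_n.+1) : f i < f j -> g i < g j.
  move=> lt_ij; apply: proper_card; rewrite properE; apply/andP; split.
    by apply/subsetP=> k; rewrite !inE => /ltn_trans; apply.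
  by apply/subsetPn; exists i; rewrite inE ?ltnn.
have inj_f (i j : 'I_n.+1) : f i = f j -> i = j.
  move=> eq_f; case: (ltngtP i j) => [lt_ij|lt_ji|/val_inj] //.
    have [|/eqP] := Hf i j; first by rewrite lt_ij /= -ltnS ltn_ord.
  by rewrite eq_f.
  have [|/eqP] := Hf j i; first by rewrite lt_ji /= -ltnS ltn_ord.
  by rewrite eq_f.
have ltE (i j : 'I_n.+1) : (g i < g j) = (f i < f j).
  case: (ltngtP (f i) (f j)) => [/mono_g //|/mono_g/ltnW|/inj_f->].
    by rewrite leqNgt => /negbTE.
  exact: ltnn.
have inj_g : injective g.
  move=> i j eq_g; apply: inj_f.
  by case: (ltngtP (f i) (f j)) => //; rewrite -ltE eq_g ltnn.
exists (perm inj_g); apply/has_orderP=> i j lt_ij; rewrite !permE ltE.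
by have [|_] := Hf i j; first by rewrite lt_ij /= -ltnS ltn_ord.
Qed.

(** Choosing a permutation of order [r m] for each [m <= n] injects ['I_n.+1] into the permutations;
    the image is [A] because an order determines its permutation. *)
Lemma card_order_family n (r : nat -> rel nat) (A : {set 'S_n.+1}) :
    (forall m, m <= n -> exists f : nat -> nat,
       forall i j, i < j <= n -> f i != f j /\ (f i < f j) = r m i j) ->
    (forall m m', m < m' <= n ->
       exists i j, i < j <= n /\ r m i j != r m' i j) ->
    (forall pi, reflect (exists2 m, m <= n & has_order (r m) pi) (pi \in A)) ->
  #|A| = n.+1.
Proof.
move=> Hex Hneq HA.
have exg (m : 'I_n.+1) : exists pi : 'S_n.+1, has_order (r m) pi.
  have [|f Hf] := Hex m; first by rewrite -ltnS.
  exact: has_order_exists Hf.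
have [g Hg] := fin_all_exists exg.
have neq_g (m m' : 'I_n.+1) : m < m' -> g m <> g m'.
  move=> lt_m eq_g; have [|i [j [/andP[lt_ij le_jn] /eqP[]]]] := Hneq m m'.
    by rewrite lt_m /= -ltnS ltn_ord.
  have lt_i : i < n.+1 by apply: ltn_trans lt_ij _.
  have /has_orderP/(_ (Ordinal lt_i) (Ordinal (le_jn : j < n.+1)) lt_ij) := Hg m.
  have /has_orderP/(_ (Ordinal lt_i) (Ordinal (le_jn : j < n.+1)) lt_ij) := Hg m'.
  by rewrite /= eq_g => -> .
have inj_g : injective g.
  move=> m m' eq_g; case: (ltngtP m m') => [/neq_g|/neq_g|/val_inj] //.
  by rewrite eq_g.
rewrite (_ : A = g @: setT) ?card_imset ?cardsT ?card_ord //.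
apply/setP=> pi; apply/HA/imsetP => [[m le_m Hm]|[m _ ->]]; last first.
  by exists m => //; rewrite -ltnS.
exists (Ordinal (le_m : m < n.+1)) => //.
exact: has_order_inj Hm (Hg (Ordinal (le_m : m < n.+1))).
Qed.

(** * Positions where a predicate changes *)

Lemma first_failure (Q : pred nat) n :
  exists2 m, m <= n & (forall i, i < m -> Q i) /\ (m < n -> ~~ Q m).
Proof.
elim: n => [|n [m le_mn [Qlt Qm]]]; first by exists 0.
case: (ltngtP m n) le_mn => // [lt_mn|eq_mn] _.
  by exists m; [lia | split=> // _; apply: Qm].
case Qn: (Q n); last by exists n => //; split=> [i|_]; rewrite ?Qn // -eq_mn; apply: Qlt.
exists n.+1 => //; split=> [i|]; last by rewrite ltnn.
by rewrite ltnS leq_eqVlt => /orP[/eqP->//|]; rewrite -eq_mn; apply: Qlt.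
Qed.

(** The witness is the last position in [[j, k)] where [Q] fails. *)
Lemma crossing (Q : pred nat) j k :
  j < k -> ~~ Q j -> Q k -> exists l, [/\ j <= l, l < k, ~~ Q l & Q l.+1].
Proof.
elim: k => // k IH; rewrite ltnS leq_eqVlt => /orP[/eqP <-|lt_jk] nQj Qk.
  by exists j.
case Qk': (Q k); last by exists k; rewrite Qk' ltnW // ltnSn.
by have [l [? ? ? ?]] := IH lt_jk nQj Qk'; exists l; split=> //; lia.
Qed.

Lemma order_iso3 x y z a b c :
  order_iso [:: x; y; z] [:: a; b; c] =
  [&& (x < y) == (a < b), (y < x) == (b < a), (x < z) == (a < c),
      (z < x) == (c < a), (y < z) == (b < c) & (z < y) == (c < b)].
Proof.
apply/andP/idP => [[_ /forallP H]|
  /and5P[/eqP h1 /eqP h2 /eqP h3 /eqP h4 /andP[/eqP h5 /eqP h6]]].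
  have E u v : u < 3 -> v < 3 ->
      (nth 0 [:: x; y; z] u < nth 0 [:: x; y; z] v) ==
      (nth 0 [:: a; b; c] u < nth 0 [:: a; b; c] v).
    by move=> lt_u lt_v; have /forallP/(_ (Ordinal lt_v)) := H (Ordinal lt_u).
  by rewrite (E 0 1) // (E 1 0) // (E 0 2) // (E 2 0) // (E 1 2) // (E 2 1).
split=> //; apply/forallP=> -[[|[|[|u]]] lt_u] //; apply/forallP=> -[[|[|[|v]]] lt_v] //=;
  by rewrite ?ltnn ?h1 ?h2 ?h3 ?h4 ?h5 ?h6.
Qed.

(** * Orders forced on sequences with distinct entries *)

Section Sequences.

Variables (n : nat) (p : nat -> nat).
Hypothesis p_inj : forall i j, i < j <= n -> p i <> p j.

(** In these names an underscore between digits is a dash: [no_2_3_1] and [no_3_1_2] are classical,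
    [no_213] is consecutive. *)
Definition no_1_23 := forall i j, i < j < n -> ~~ (p i < p j < p j.+1).
Definition no_3_12 := forall i j, i < j < n -> ~~ ((p j < p j.+1) && (p j.+1 < p i)).
Definition no_23_1 := forall i k, i.+1 < k <= n -> ~~ ((p k < p i) && (p i < p i.+1)).
Definition no_21_3 := forall i k, i.+1 < k <= n -> ~~ ((p i.+1 < p i) && (p i < p k)).
Definition no_2_3_1 := forall i j k, i < j -> j < k <= n -> ~~ ((p k < p i) && (p i < p j)).
Definition no_3_1_2 := forall i j k, i < j -> j < k <= n -> ~~ ((p j < p k) && (p k < p i)).
Definition no_213 := forall i, i.+1 < n -> ~~ ((p i.+1 < p i) && (p i < p i.+2)).

Lemma dec_range a b : (forall i, a <= i < b -> p i.+1 < p i) ->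
  forall i j, a <= i -> i < j <= b -> p j < p i.
Proof.
move=> H i j le_ai; elim: j => // j IH lt_ij.
have := H j; have [->|ne_ij] := eqVneq j i; first by move=> H'; apply: H'; lia.
by have := IH; lia.
Qed.

Lemma first_ascent :
  exists2 m, m <= n & (forall i, i < m -> p i.+1 < p i) /\ (m < n -> p m < p m.+1).
Proof.
have [m le_mn [Hlt Hm]] := first_failure (fun i => p i.+1 < p i) n.
exists m => //; split=> // lt_mn; have := Hm lt_mn.
by have := @p_inj m m.+1; lia.
Qed.

(** After position 0 the entries decrease, so those above [p 0] occupy an initial segment [1..m] of
    the tail. *)
Lemma order_family1 : (forall i, 0 < i < n -> p i.+1 < p i) ->
  exists2 m, m <= n &
    forall i j, i < j <= n -> (p i < p j) = (i == 0) && (j <= m).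
Proof.
move=> /dec_range dec.
have [m le_mn [Hlt Hm]] := first_failure (fun i => p 0 < p i.+1) n.
exists m => // i j lt_ij.
case: (posnP i) => [i0|i_gt0]; last first.
  by have := dec i j i_gt0 lt_ij; lia.
subst i; case: (leqP j m) => [le_jm|lt_mj].
  by case: j lt_ij le_jm => // j _ /Hlt ->.
have lt_mn : m < n by lia.
have := Hm lt_mn; have := @p_inj 0 m.+1.
have [->|ne_j] := eqVneq j m.+1; first by lia.
by have := dec m.+1 j; lia.
Qed.

(** Past the first ascent [m], avoiding 23-1 keeps all entries above [p m]; a second ascent would
    then complete a 1-23 starting at [m]. *)
Lemma single_ascent : no_1_23 -> no_23_1 ->
  exists2 m, m <= n & [/\ forall i, i < m -> p i.+1 < p i,
                           m < n -> p m < p m.+1 &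
                           forall i, m < i < n -> p i.+1 < p i].
Proof.
move=> H1 H2; have [m le_mn [Hlt Hm]] := first_ascent.
exists m => //; split=> // i lt_mi.
have := @p_inj i i.+1; have := @p_inj m i; have := H1 m i; have := Hm.
have [->|ne_i] := eqVneq i m.+1; first by lia.
by have := H2 m i; lia.
Qed.

(** There are two decreasing runs, [0..m] and [m+1..n]. The triple at [m-1], [m], [m+1] is not a
    213, so [p m.-1], the least entry before [m], exceeds [p m.+1], the greatest after [m]. *)
Lemma order_family2 : no_1_23 -> no_213 -> no_23_1 ->
  exists2 m, m <= n & forall i j, i < j <= n -> (p i < p j) = (i == m).
Proof.
move=> H1 H2 H3; have [m le_mn [Hlt Hm Hgt]] := single_ascent H1 H3.
have dec1 : forall i j, 0 <= i -> i < j <= m -> p j < p i by apply: dec_range.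
have dec2 : forall i j, m.+1 <= i -> i < j <= n -> p j < p i by apply: dec_range.
exists m => // i j lt_ij; case: (ltngtP i m) => [lt_im|lt_mi|eq_im].
- have [le_jm|lt_mj] := leqP j m; first by have := dec1 i j; lia.
  have le1 : p m.-1 <= p i.
    by have [->//|ne] := eqVneq i m.-1; have := dec1 i m.-1; lia.
  have le2 : p j <= p m.+1.
    by have [->//|ne] := eqVneq j m.+1; have := dec2 m.+1 j; lia.
  have := H2 m.-1; have := Hlt m.-1; rewrite prednK; last by lia.
  by have := @p_inj m.-1 m.+1; lia.
- by have := dec2 i j; lia.
- subst i; have [->|ne] := eqVneq j m.+1; first by apply: Hm; lia.
  by have := H3 m j; have := @p_inj m j; lia.
Qed.

(** Ascents persist, so the sequence falls up to [m] and then rises. Avoiding 21-3 at [m-1], [m]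
    puts every entry after [m] below [p m.-1], the least entry before [m]. *)
Lemma order_family3 : (forall i, i.+1 < n -> p i < p i.+1 -> p i.+1 < p i.+2) ->
    no_21_3 ->
  exists2 m, m <= n & forall i j, i < j <= n -> (p i < p j) = (m <= i).
Proof.
move=> Hasc H; have [m le_mn [Hlt Hm]] := first_ascent.
have dec : forall i j, 0 <= i -> i < j <= m -> p j < p i by apply: dec_range.
have asc1 i : m <= i < n -> p i < p i.+1.
  elim: i => [|i IH] le_mi; first by have := Hm; rewrite (_ : m = 0); lia.
  have [eq_mi|ne] := eqVneq m i.+1; first by rewrite -eq_mi; apply: Hm; lia.
  by apply: Hasc; [lia | apply: IH; lia].
have asc i j : m <= i -> i < j <= n -> p i < p j.
  move=> le_mi; elim: j => // j IH lt_ij; have := asc1 j.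
  by have [->|ne] := eqVneq j i; [lia | have := IH; lia].
exists m => // i j lt_ij; have [le_mi|lt_im] := leqP m i; first by apply: asc.
have [le_jm|lt_mj] := leqP j m; first by have := dec i j; lia.
have le1 : p m.-1 <= p i.
  by have [->//|ne] := eqVneq i m.-1; have := dec i m.-1; lia.
have := H m.-1 j; have := Hlt m.-1; have := @p_inj m.-1 j; rewrite prednK; lia.
Qed.

Lemma order_family4 : no_1_23 -> no_23_1 -> no_3_12 -> no_2_3_1 \/ no_3_1_2 ->
  exists2 m, m <= n & forall i j, i < j <= n -> (p i < p j) = (i <= m < j).
Proof.
move=> H1 H2 H3 H4; have [m le_mn [Hlt Hm Hgt]] := single_ascent H1 H2.
have dec1 : forall i j, 0 <= i -> i < j <= m -> p j < p i by apply: dec_range.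
have dec2 : forall i j, m.+1 <= i -> i < j <= n -> p j < p i by apply: dec_range.
exists m => // i j lt_ij.
have [le_jm|lt_mj] := leqP j m; first by have := dec1 i j; lia.
have [le_im|lt_mi] := leqP i m; last by have := dec2 i j; lia.
have lt_mn : m < n by lia.
(* [p 0] is the maximum of the first decreasing run, so it is enough that every entry of the second
   run exceeds it. *)
have le_0 : p i <= p 0 by case: (posnP i) => [->//|?]; have := dec1 0 i; lia.
have lt_0 : p 0 < p m.+1.
  case: (posnP m) => [m0|m_gt0]; first by have := Hm lt_mn; rewrite m0.
  by have := H3 0 m; have := @p_inj 0 m.+1; have := Hm lt_mn; lia.
suff: p 0 < p j by lia.
have [->//|ne] := eqVneq j m.+1.
(* If [p j < p 0], positions [0], [m+1], [j] form a 231. For [m > 0], avoiding 23-1 also gives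
   [p m < p j], so [0], [m], [j] form a 312. *)
have := @p_inj 0 j; have := @p_inj m j.
case: H4 => H4; first by have := H4 0 m.+1 j; lia.
case: (posnP m) => [m0|m_gt0]; last first.
  by have := H4 0 m j; have := dec1 0 m; have := H2 m j; lia.
by subst m; have := H2 0 j; lia.
Qed.

Lemma no_2_13_no_21_3 :
  (forall i j, i < j < n -> ~~ ((p j < p i) && (p i < p j.+1))) -> no_21_3.
Proof.
move=> H i k lt_ik; apply/negP=> /andP[lt1 lt2].
(* The middle value is [p i]; an upward crossing after [i+1] yields an adjacent 13. *)
have [||l [le_l lt_l]] := @crossing (fun l => p i < p l) i.+1 k _ _ lt2; [lia..|].
by have := H i l; have := @p_inj i l; lia.
Qed.

Lemma no_2_31_no_2_3_1 :
  (forall i j, i < j < n -> ~~ ((p j.+1 < p i) && (p i < p j))) -> no_2_3_1.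
Proof.
move=> H i j k lt_ij lt_jk; apply/negP=> /andP[lt1 lt2].
have [||l [le_l lt_l]] := @crossing (fun l => p l < p i) j k _ _ lt1; [lia..|].
by have := H i l; have := @p_inj i l; lia.
Qed.

Lemma no_31_2_no_3_1_2 :
  (forall i k, i.+1 < k <= n -> ~~ ((p i.+1 < p k) && (p k < p i))) -> no_3_1_2.
Proof.
move=> H i j k lt_ij lt_jk; apply/negP=> /andP[lt1 lt2].
(* Here the middle value is the last entry [p k], and the downward crossing lies between [i] and
   [j]. *)
have [||l [le_l lt_l]] := @crossing (fun l => p l < p k) i j _ _ lt1; [lia..|].
by have := H l k; have := @p_inj l k; lia.
Qed.

End Sequences.

(** * From patterns in permutations to inequalities between entries *)

(* The underlying classical pattern, forgetting the dash. *)
Definition shape (q : gpattern) : nat * nat * nat := (gpattern_code q).2.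

Definition occurs (p : nat -> nat) (t : nat * nat * nat) i j k : bool :=
  order_iso [:: p i; p j; p k] [:: t.1.1; t.1.2; t.2].

(** Beyond [n], [inord] falls back to position 0, hence the bounds [<= n] throughout. *)
Definition at_pos n (pi : 'S_n.+1) (i : nat) : nat := pi (inord i).

Lemma at_pos_inj n (pi : 'S_n.+1) i j : i < j <= n -> at_pos pi i <> at_pos pi j.
Proof.
move=> lt_ij /val_inj/perm_inj/(congr1 val) /=; rewrite !inordK; lia.
Qed.

Lemma avoids_A_BC n (pi : 'S_n.+1) a b c : avoids pi (A_BC a b c) ->
  forall i j, i < j < n -> ~~ occurs (at_pos pi) (a, b, c) i j j.+1.
Proof.
move=> /existsPn H i j lt_ij; apply/negP=> Hocc.
have /existsPn/(_ (inord j))/existsPn/(_ (inord j.+1)) := H (inord i).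
by rewrite [order_iso _ _]Hocc !inordK ?eqxx ?andbT; lia.
Qed.

Lemma avoids_AB_C n (pi : 'S_n.+1) a b c : avoids pi (AB_C a b c) ->
  forall i k, i.+1 < k <= n -> ~~ occurs (at_pos pi) (a, b, c) i i.+1 k.
Proof.
move=> /existsPn H i k lt_ik; apply/negP=> Hocc.
have /existsPn/(_ (inord i.+1))/existsPn/(_ (inord k)) := H (inord i).
by rewrite [order_iso _ _]Hocc !inordK ?eqxx ?andbT; lia.
Qed.

Lemma avoids_consecutive n (pi : 'S_n.+1) q : avoids pi q ->
  forall i, i.+1 < n -> ~~ occurs (at_pos pi) (shape q) i i.+1 i.+2.
Proof.
case: q => a b c H i lt_i; first by apply: (avoids_A_BC H); lia.
by apply: (avoids_AB_C H); lia.
Qed.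

Lemma has_order_avoids n (r : rel nat) (pi : 'S_n.+1) q : has_order r pi ->
    (forall (v : nat -> nat) i j k, i < j < k ->
       (v i < v j) = r i j -> (v i < v k) = r i k -> (v j < v k) = r j k ->
       ~~ occurs v (shape q) i j k) ->
  avoids pi q.
Proof.
move=> /has_orderP Hr Hq.
have no (i j k : 'I_n.+1) : i < j < k ->
    ~~ order_iso [:: val (pi i); val (pi j); val (pi k)]
         [:: (shape q).1.1; (shape q).1.2; (shape q).2].
  move=> /andP[lt_ij lt_jk]; have := Hq (at_pos pi) i j k.
  rewrite /occurs /at_pos !inord_val; apply; rewrite ?lt_ij ?Hr //.
  exact: ltn_trans lt_jk.
rewrite /avoids; case: q Hq no => a b c _ no; apply/existsPn=> i;
  apply/existsPn=> j; apply/existsPn=> k; apply/negP.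
  by case/and3P=> lt_ij /eqP eq_k; apply/negP; apply: no; rewrite lt_ij eq_k /=.
by case/and3P=> /eqP eq_j lt_jk; apply/negP; apply: no; rewrite lt_jk eq_j ltnSn.
Qed.

(** The first half lets a permutation avoiding [T] avoid [P]; the second provides, for each shape in
    [T], a pattern of [P] to exploit in the converse. *)
Definition same_shapes (T : seq (nat * nat * nat)) (P : seq gpattern) : bool :=
  all (fun q => shape q \in T) P && all (fun t => t \in map shape P) T.

Lemma card_avoiders_family n P T (r : nat -> rel nat) :
    same_shapes T P ->
    (forall m, m <= n -> exists f : nat -> nat,
       forall i j, i < j <= n -> f i != f j /\ (f i < f j) = r m i j) ->
    (forall m m', m < m' <= n ->
       exists i j, i < j <= n /\ r m i j != r m' i j) ->
    (forall m (v : nat -> nat) t i j k, i < j < k -> t \in T ->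
       (v i < v j) = r m i j -> (v i < v k) = r m i k -> (v j < v k) = r m j k ->
       ~~ occurs v t i j k) ->
    (forall pi : 'S_n.+1, {in P, forall q, avoids pi q} ->
       exists2 m, m <= n &
         forall i j, i < j <= n -> (at_pos pi i < at_pos pi j) = r m i j) ->
  #|avoiders n.+1 P| = n.+1.
Proof.
move=> /andP[/allP PT _] Hex Hneq Havoid Horder.
apply: (card_order_family Hex Hneq) => pi; rewrite inE.
apply: (iffP allP) => [/Horder[m le_m Hm]|[m _ Hm] q qP].
  exists m => //; apply/has_orderP=> i j lt_ij.
  have := Hm i j; rewrite /at_pos !inord_val; apply.
  by rewrite lt_ij /= -ltnS ltn_ord.
by apply: has_order_avoids Hm _ => v i j k lt_ijk; apply: Havoid => //; apply: PT.
Qed.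

Lemma same_shapes_mem T P t : same_shapes T P -> t \in T ->
  exists2 q, q \in P & shape q = t.
Proof.
by move=> /andP[_ /allP TP] /TP/mapP[q qP ->]; exists q.
Qed.

Lemma shape_cases q a b c : shape q = (a, b, c) ->
  q = A_BC a b c \/ q = AB_C a b c.
Proof. by case: q => x y z [-> -> ->]; [left | right]. Qed.

Lemma same_shapes_consecutive T P n (pi : 'S_n.+1) t :
    same_shapes T P -> {in P, forall q, avoids pi q} -> t \in T ->
  forall i, i.+1 < n -> ~~ occurs (at_pos pi) t i i.+1 i.+2.
Proof.
move=> PT av tT; have [q qP <-] := same_shapes_mem PT tT.
exact: avoids_consecutive (av q qP).
Qed.

Section AvoidedForms.

Variables (n : nat) (pi : 'S_n.+1).
Let p := at_pos pi.

Lemma avoids_1_23 : avoids pi [gp 1 - 2 3] -> no_1_23 n p.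
Proof.
move=> /avoids_A_BC H i j lt_ij; have := H i j lt_ij.
by rewrite /occurs order_iso3 -/p /=; lia.
Qed.

Lemma avoids_2_31 : avoids pi [gp 2 - 3 1] -> no_2_3_1 n p.
Proof.
move=> /avoids_A_BC H; apply: no_2_31_no_2_3_1; first exact: at_pos_inj.
by move=> i j lt_ij; have := H i j lt_ij; rewrite /occurs order_iso3 -/p /=; lia.
Qed.

Lemma avoids_31_2 : avoids pi [gp 3 1 - 2] -> no_3_1_2 n p.
Proof.
move=> /avoids_AB_C H; apply: no_31_2_no_3_1_2; first exact: at_pos_inj.
by move=> i j lt_ij; have := H i j lt_ij; rewrite /occurs order_iso3 -/p /=; lia.
Qed.

(** Either place of the dash gives 23-1: for 2-31 it follows from avoidance of the classical
    pattern. *)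
Lemma avoids_231 q : shape q = (2, 3, 1) -> avoids pi q -> no_23_1 n p.
Proof.
move=> /shape_cases[->|->].
  by move=> /avoids_2_31 H i k lt_ik; apply: H; lia.
move=> /avoids_AB_C H i k lt_ik; have := H i k lt_ik.
by rewrite /occurs order_iso3 -/p /=; lia.
Qed.

Lemma avoids_312 q : shape q = (3, 1, 2) -> avoids pi q -> no_3_12 n p.
Proof.
move=> /shape_cases[->|->]; last first.
  by move=> /avoids_31_2 H i j lt_ij; apply: H; lia.
move=> /avoids_A_BC H i j lt_ij; have := H i j lt_ij.
by rewrite /occurs order_iso3 -/p /=; lia.
Qed.

Lemma avoids_213 q : shape q = (2, 1, 3) -> avoids pi q -> no_21_3 n p.
Proof.
move=> /shape_cases[->|->].
  move=> /avoids_A_BC H; apply: no_2_13_no_21_3; first exact: at_pos_inj.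
  by move=> i j lt_ij; have := H i j lt_ij; rewrite /occurs order_iso3 -/p /=; lia.
move=> /avoids_AB_C H i k lt_ik; have := H i k lt_ik.
by rewrite /occurs order_iso3 -/p /=; lia.
Qed.

End AvoidedForms.

(** * Counting the avoiders for each of the four triples *)

Definition shapes1 := [:: (1, 2, 3); (2, 1, 3); (3, 1, 2)].
Definition shapes2 := [:: (1, 2, 3); (2, 1, 3); (2, 3, 1)].
Definition shapes3 := [:: (2, 1, 3); (2, 3, 1); (1, 3, 2)].
Definition shapes4 := [:: (1, 2, 3); (2, 3, 1); (3, 1, 2)].

Lemma card_avoiders_family1 n P : same_shapes shapes1 P ->
  #|avoiders n.+1 P| = n.+1.
Proof.
move=> PT; pose r m i j := (i == 0) && (j <= m).
apply: (@card_avoiders_family n P shapes1 r) => //.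
(* Later positions take decreasing even values; the odd value at 0 falls between those of positions
   [m] and [m+1]. *)
- move=> m le_mn; exists (fun i => if i == 0 then (n - m).*2.+1 else (n - i).+1.*2).
  by move=> i j lt_ij; rewrite /r; case: (i =P 0); case: (j =P 0); lia.
- by move=> m m' lt_m; exists 0, m'; rewrite /r; lia.
- move=> m v t i j k lt_ijk; rewrite !inE /r => /or3P[]/eqP-> h1 h2 h3;
    rewrite /occurs order_iso3 /=; lia.
move=> pi av; apply: order_family1 => [|i lt_i]; first exact: at_pos_inj.
(* 123, 213 and 312 are exactly the shapes ending in an ascent, so none can start at [i > 0]. *)
have H t tT := @same_shapes_consecutive _ _ _ _ t PT av tT i.-1.
have := H (1, 2, 3) isT; have := H (2, 1, 3) isT; have := H (3, 1, 2) isT.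
have inj := @at_pos_inj n pi; rewrite /occurs !order_iso3 /= prednK; last by lia.
by have := inj i i.+1; have := inj i.-1 i.+1; have := inj i.-1 i; lia.
Qed.

Lemma card_avoiders_family2 n P : same_shapes shapes2 P ->
  [gp 1 - 2 3] \in P -> #|avoiders n.+1 P| = n.+1.
Proof.
move=> PT P123; pose r m (i j : nat) := i == m.
apply: (@card_avoiders_family n P shapes2 r) => //.
- move=> m le_mn; exists (fun i => if i == m then 0 else (n - i).+1).
  by move=> i j lt_ij; rewrite /r; case: (i =P m); case: (j =P m); lia.
- by move=> m m' lt_m; exists m, m'; rewrite /r; lia.
- move=> m v t i j k lt_ijk; rewrite !inE /r => /or3P[]/eqP-> h1 h2 h3;
    rewrite /occurs order_iso3 /=; lia.
move=> pi av; apply: order_family2; first exact: at_pos_inj.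
- exact: avoids_1_23 (av _ P123).
- move=> i lt_i.
  have := @same_shapes_consecutive _ _ _ _ (2, 1, 3) PT av isT i lt_i.
  by rewrite /occurs order_iso3 /=; lia.
- have [q qP sq] := @same_shapes_mem _ _ (2, 3, 1) PT isT.
  exact: avoids_231 sq (av q qP).
Qed.

Lemma card_avoiders_family3 n P : same_shapes shapes3 P ->
  #|avoiders n.+1 P| = n.+1.
Proof.
move=> PT; pose r m (i j : nat) := m <= i.
apply: (@card_avoiders_family n P shapes3 r) => //.
(* For [i < m <= n] the value [n.*2 - i] exceeds [n], so the falling part lies above the rising
   one. *)
- move=> m le_mn; exists (fun i => if i < m then n.*2 - i else i).
  by move=> i j lt_ij; rewrite /r; case: ifP; case: ifP; lia.
- by move=> m m' lt_m; exists m, m'; rewrite /r; lia.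
- move=> m v t i j k lt_ijk; rewrite !inE /r => /or3P[]/eqP-> h1 h2 h3;
    rewrite /occurs order_iso3 /=; lia.
move=> pi av; apply: order_family3; first exact: at_pos_inj.
- move=> i lt_i.
  (* An ascent followed by a descent is a 231 or a 132. *)
  have H t tT := @same_shapes_consecutive _ _ _ _ t PT av tT i lt_i.
  have := H (2, 3, 1) isT; have := H (1, 3, 2) isT; rewrite /occurs !order_iso3 /=.
  have inj := @at_pos_inj n pi.
  by have := inj i i.+1; have := inj i i.+2; have := inj i.+1 i.+2; lia.
- have [q qP sq] := @same_shapes_mem _ _ (2, 1, 3) PT isT.
  exact: avoids_213 sq (av q qP).
Qed.

Lemma card_avoiders_family4 n P : same_shapes shapes4 P ->
  [gp 1 - 2 3] \in P -> ([gp 2 - 3 1] \in P) || ([gp 3 1 - 2] \in P) ->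
  #|avoiders n.+1 P| = n.+1.
Proof.
move=> PT P123 Pcl; pose r m (i j : nat) := i <= m < j.
apply: (@card_avoiders_family n P shapes4 r) => //.
(* The offset [n.+1] lifts the second decreasing run above the first. *)
- move=> m le_mn; exists (fun i => if i <= m then n - i else n.+1 + (n - i)).
  by move=> i j lt_ij; rewrite /r; case: ifP; case: ifP; lia.
- by move=> m m' lt_m; exists m, m'; rewrite /r; lia.
- move=> m v t i j k lt_ijk; rewrite !inE /r => /or3P[]/eqP-> h1 h2 h3;
    rewrite /occurs order_iso3 /=; lia.
move=> pi av; apply: order_family4; first exact: at_pos_inj.
- exact: avoids_1_23 (av _ P123).
- have [q qP sq] := @same_shapes_mem _ _ (2, 3, 1) PT isT.
  exact: avoids_231 sq (av q qP).
- have [q qP sq] := @same_shapes_mem _ _ (3, 1, 2) PT isT.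
  exact: avoids_312 sq (av q qP).
- case/orP: Pcl => /av; first by left; apply: avoids_2_31.
  by right; apply: avoids_31_2.
Qed.

(** * Sorting the 38 sets into the four families *)

Definition in_some_family (P : seq gpattern) : bool :=
  [|| same_shapes shapes1 P,
      same_shapes shapes2 P && ([gp 1 - 2 3] \in P),
      same_shapes shapes3 P
    | [&& same_shapes shapes4 P, [gp 1 - 2 3] \in P &
          ([gp 2 - 3 1] \in P) || ([gp 3 1 - 2] \in P)]].

Lemma card_avoiders_in_some_family n P : in_some_family P ->
  #|avoiders n.+1 P| = n.+1.
Proof.
case/or4P => [|/andP[]||/and3P[]].
- exact: card_avoiders_family1.
- exact: card_avoiders_family2.
- exact: card_avoiders_family3.
- exact: card_avoiders_family4.
Qed.

Theorem mainTheorem1 (P : seq gpattern)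
  (hP : P \in [::
       [:: [gp 1 - 2 3]; [gp 2 - 1 3]; [gp 3 - 1 2]; [gp 2 1 - 3]];
       [:: [gp 1 - 2 3]; [gp 2 - 1 3]; [gp 3 1 - 2]; [gp 2 1 - 3]];
       [:: [gp 1 - 2 3]; [gp 2 - 1 3]; [gp 3 1 - 2]; [gp 3 - 1 2]];
       [:: [gp 1 - 2 3]; [gp 2 1 - 3]; [gp 3 1 - 2]; [gp 3 - 1 2]];
       [:: [gp 1 2 - 3]; [gp 3 - 1 2]; [gp 2 - 1 3]; [gp 2 1 - 3]];
       [:: [gp 1 2 - 3]; [gp 3 1 - 2]; [gp 2 - 1 3]; [gp 2 1 - 3]];
       [:: [gp 1 2 - 3]; [gp 3 1 - 2]; [gp 2 - 1 3]; [gp 3 - 1 2]];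
       [:: [gp 1 2 - 3]; [gp 3 1 - 2]; [gp 2 1 - 3]; [gp 3 - 1 2]];
       [:: [gp 1 - 2 3]; [gp 2 - 1 3]; [gp 2 - 3 1]; [gp 2 1 - 3]];
       [:: [gp 1 - 2 3]; [gp 2 - 1 3]; [gp 2 - 3 1]; [gp 2 3 - 1]];
       [:: [gp 1 - 2 3]; [gp 2 - 1 3]; [gp 2 3 - 1]; [gp 2 1 - 3]];
       [:: [gp 1 - 2 3]; [gp 2 1 - 3]; [gp 2 - 3 1]; [gp 2 3 - 1]];
       [:: [gp 2 - 1 3]; [gp 2 - 3 1]; [gp 1 - 3 2]; [gp 2 1 - 3]];
       [:: [gp 2 - 1 3]; [gp 2 - 3 1]; [gp 1 - 3 2]; [gp 2 3 - 1]];
       [:: [gp 2 - 1 3]; [gp 2 3 - 1]; [gp 1 - 3 2]; [gp 2 1 - 3]];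
       [:: [gp 2 - 1 3]; [gp 2 - 3 1]; [gp 1 3 - 2]; [gp 2 1 - 3]];
       [:: [gp 2 - 1 3]; [gp 2 - 3 1]; [gp 1 3 - 2]; [gp 2 3 - 1]];
       [:: [gp 2 - 1 3]; [gp 2 - 3 1]; [gp 1 3 - 2]; [gp 1 - 3 2]];
       [:: [gp 2 - 1 3]; [gp 2 3 - 1]; [gp 1 3 - 2]; [gp 2 1 - 3]];
       [:: [gp 2 - 1 3]; [gp 2 3 - 1]; [gp 1 3 - 2]; [gp 1 - 3 2]];
       [:: [gp 2 - 3 1]; [gp 2 1 - 3]; [gp 1 3 - 2]; [gp 2 3 - 1]];
       [:: [gp 2 - 3 1]; [gp 2 1 - 3]; [gp 1 3 - 2]; [gp 1 - 3 2]];
       [:: [gp 2 - 3 1]; [gp 2 1 - 3]; [gp 1 - 3 2]; [gp 2 3 - 1]];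
       [:: [gp 1 3 - 2]; [gp 2 1 - 3]; [gp 2 3 - 1]; [gp 1 - 3 2]];
       [:: [gp 1 - 2 3]; [gp 2 - 3 1]; [gp 3 1 - 2]; [gp 2 3 - 1]];
       [:: [gp 1 - 2 3]; [gp 2 - 3 1]; [gp 3 1 - 2]; [gp 3 - 1 2]];
       [:: [gp 1 - 2 3]; [gp 2 3 - 1]; [gp 3 1 - 2]; [gp 3 - 1 2]];
       [:: [gp 1 - 2 3]; [gp 2 - 3 1]; [gp 3 - 1 2]; [gp 2 3 - 1]];
       [:: [gp 1 - 2 3]; [gp 2 - 1 3]; [gp 3 1 - 2]; [gp 1 2 - 3]];
       [:: [gp 1 - 2 3]; [gp 2 - 1 3]; [gp 3 - 1 2]; [gp 1 2 - 3]];
       [:: [gp 1 - 2 3]; [gp 2 - 1 3]; [gp 2 - 3 1]; [gp 1 2 - 3]];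
       [:: [gp 1 - 2 3]; [gp 2 - 1 3]; [gp 2 3 - 1]; [gp 1 2 - 3]];
       [:: [gp 1 - 2 3]; [gp 2 1 - 3]; [gp 2 - 3 1]; [gp 1 2 - 3]];
       [:: [gp 1 - 2 3]; [gp 2 1 - 3]; [gp 2 3 - 1]; [gp 1 2 - 3]];
       [:: [gp 1 - 2 3]; [gp 2 1 - 3]; [gp 3 1 - 2]; [gp 1 2 - 3]];
       [:: [gp 1 - 2 3]; [gp 2 1 - 3]; [gp 3 - 1 2]; [gp 1 2 - 3]];
       [:: [gp 1 - 2 3]; [gp 2 - 3 1]; [gp 3 - 1 2]; [gp 1 2 - 3]];
       [:: [gp 1 - 2 3]; [gp 2 - 3 1]; [gp 3 1 - 2]; [gp 1 2 - 3]]])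
  (n : nat) (hn : 1 <= n) :
  #|avoiders n P| = n.
Proof.
case: n hn => // n _; apply: card_avoiders_in_some_family.
(* [in_some_family] is boolean, so all 38 sets are checked by computation. *)
by move: P hP; apply/allP.
Qed.
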